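(* Let $S$ be an arbitrary (not necessarily finite) semigroup with zero $0$ such that the radical $R(S)$ is nilpotent. Then every maximal nilpotent subsemigroup of $S$ contains $R(S)$. In particular, the canonical epimorphism $\varphi$ from $S$ to the Rees quotient $S/R(S)$ induces a bijection between the maximal nilpotent subsemigroups of $S$ and the maximal nilpotent subsemigroups of $S/R(S)$.
   Context: $S^1$ is $S$ with an identity adjoined if $S$ has none; $(x)=S^1xS^1$. A subsemigroup $T$ of $S$ is nilpotent if $T^m=\{0\}$ for some $m\in\mathbb{N}$; a maximal nilpotent subsemigroup is an inclusion-maximal nilpotent subsemigroup. The radical is $R(S)=\{x\in S:(x)\text{ is a nilpotent semigroup}\}$, a two-sided ideal. *)

(* Defs.v *)
From HB Require Import structures.
From mathcomp Require Import all_boot all_classical.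

Set Implicit Arguments.
Unset Strict Implicit.
Unset Printing Implicit Defensive.

Import Algebra.

Local Open Scope classical_set_scope.
Local Open Scope group_scope.

HB.mixin Record Semigroup_hasZero S of Semigroup S := {
  zero : S;
  mul0s : left_zero zero (@mul S);
  muls0 : right_zero zero (@mul S)
}.

#[short(type="zeroSemigroupType")]
HB.structure Definition ZeroSemigroup :=
  {S of Semigroup_hasZero S & Semigroup S}.

Notation "0" := (@zero _) : group_scope.

Section SubsetsOfSemigroup.
Variable S : semigroupType.
Implicit Types A B : set S.

Definition setmul A B : set S := [set x * y | x in A & y in B].

(* [setpow A m] is the set of products of [m] elements of [A], for [m > 0];
   the value at [m = 0] is [A] and carries no meaning. *)
Definition setpow A (m : nat) : set S := iter m.-1 (setmul A) A.

(* The empty set is allowed here, but it is never nilpotent. *)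
Definition subsemigroup A : Prop := forall x y, A x -> A y -> A (x * y).

Definition has_identity : Prop :=
  exists e : S, left_id e (@mul S) /\ right_id e (@mul S).

(* [option S] under [omul] is [S] with a new identity [None]; the element
   [None] belongs to S^1 only when [S] has no identity of its own. *)
Definition omul (u v : option S) : option S :=
  match u, v with
  | Some x, Some y => Some (x * y)
  | Some x, None => Some x
  | None, _ => v
  end.

Definition S1 : set (option S) := [set u | u = None -> ~ has_identity].

Definition principal_ideal (x : S) : set S :=
  [set y | exists u v, [/\ S1 u, S1 v & Some y = omul (omul u (Some x)) v]].

Record ideal := Ideal {
  ideal_set :> set S;
  ideal_neq0 : ideal_set !=set0;
  ideal_mulr : forall x y, ideal_set x -> ideal_set (x * y);
  ideal_mull : forall x y, ideal_set y -> ideal_set (x * y)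
}.

End SubsetsOfSemigroup.

Section ReesQuotient.
Variables (S : semigroupType) (I : ideal S).

Definition rees_rel (x y : S) : bool :=
  (x == y) || (x \in (I : set S)) && (y \in (I : set S)).

Lemma rees_refl : reflexive rees_rel.
Proof. by move=> x; rewrite /rees_rel eqxx. Qed.

Lemma rees_sym : symmetric rees_rel.
Proof. by move=> x y; rewrite /rees_rel eq_sym andbC. Qed.

Lemma rees_trans : transitive rees_rel.
Proof.
move=> y x z; rewrite /rees_rel => /orP[/eqP->//|/andP[xI yI]].
by move=> /orP[/eqP<-|/andP[_ zI]]; rewrite xI ?yI ?zI orbT.
Qed.

Canonical rees_equiv := EquivRel rees_rel rees_refl rees_sym rees_trans.

Definition rees := {eq_quot rees_equiv}%qT.

HB.instance Definition _ := Choice.on rees.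

Definition rees_proj (x : S) : rees := (\pi_({eq_quot rees_equiv}) x)%qT.

Lemma rees_projK (q : rees) : rees_proj (repr q) = q.
Proof. exact: reprK. Qed.

Lemma rees_proj_eq (x y : S) : rees_proj x = rees_proj y <-> rees_rel x y.
Proof. by split=> [/eqmodP|h]; last apply/eqmodP. Qed.

Definition rees_mul (p q : rees) : rees := rees_proj (repr p * repr q).

Lemma rees_projM (x y : S) :
  rees_proj (x * y) = rees_mul (rees_proj x) (rees_proj y).
Proof.
apply/rees_proj_eq.
have xx' : rees_rel x (repr (rees_proj x)).
  by apply/rees_proj_eq; rewrite rees_projK.
have yy' : rees_rel y (repr (rees_proj y)).
  by apply/rees_proj_eq; rewrite rees_projK.
case/orP: xx' => [/eqP<-|/andP[/set_mem ? /set_mem ?]]; last first.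
  by apply/orP; right; apply/andP; split; apply/mem_set/ideal_mulr.
case/orP: yy' => [/eqP<-|/andP[/set_mem ? /set_mem ?]]; first exact: rees_refl.
by apply/orP; right; apply/andP; split; apply/mem_set/ideal_mull.
Qed.

Lemma rees_mulA : associative rees_mul.
Proof.
move=> p q r; rewrite -[p]rees_projK -[q]rees_projK -[r]rees_projK.
by rewrite -!rees_projM mulgA.
Qed.

HB.instance Definition _ := isSemigroup.Build rees rees_mulA.

HB.instance Definition _ := isMultiplicative.Build S rees rees_proj rees_projM.

End ReesQuotient.

Section ReesZero.
Variables (S : zeroSemigroupType) (I : ideal S).

Let rees0s : left_zero (rees_proj I 0) (@mul (rees I)).
Proof. by move=> p; rewrite -[p]rees_projK -[LHS]/(rees_mul _ _) -rees_projM mul0s. Qed.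

Let reess0 : right_zero (rees_proj I 0) (@mul (rees I)).
Proof. by move=> p; rewrite -[p]rees_projK -[LHS]/(rees_mul _ _) -rees_projM muls0. Qed.

HB.instance Definition _ := Semigroup_hasZero.Build (rees I) rees0s reess0.

End ReesZero.

Section Nilpotent.
Variable S : zeroSemigroupType.
Implicit Types T U : set S.

Definition nilpotent T : Prop := exists m, (0 < m)%N /\ setpow T m = [set 0].

Definition nilpotent_subsemigroup T : Prop := subsemigroup T /\ nilpotent T.

Definition maximal_nilpotent_subsemigroup T : Prop :=
  nilpotent_subsemigroup T /\
  forall U, nilpotent_subsemigroup U -> T `<=` U -> U = T.

Definition radical : set S :=
  [set x | nilpotent_subsemigroup (principal_ideal x)].

Lemma omulA : associative (@omul S).
Proof. by case=> [x|] [y|] [z|] //=; rewrite mulgA. Qed.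

Lemma principal_ideal_refl (x : S) : principal_ideal x x.
Proof.
have [[e [e1 e2]]|H] := pselect (has_identity S).
  by exists (Some e), (Some e); split=> //=; rewrite e1 e2.
by exists None, None; split.
Qed.

Lemma setpow_sub T U m : T `<=` U -> setpow T m `<=` setpow U m.
Proof.
move=> TU; rewrite /setpow; elim: m.-1 => [//|k IH] x /=.
by case=> a /TU Ua [b /IH Ub <-]; exists a => //; exists b.
Qed.

Lemma setpow_neq0 T m : T !=set0 -> setpow T m !=set0.
Proof.
move=> [x Tx]; rewrite /setpow; elim: m.-1 => [|k [y Ty]] /=; first by exists x.
by exists (x * y), x => //; exists y.
Qed.

Lemma principal_idealMr (x y : S) :
  principal_ideal (x * y) `<=` principal_ideal x.
Proof.
move=> t [u [v [u1 _ Et]]]; exists u, (omul (Some y) v).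
by split=> //; [case: v {Et} | rewrite Et -[Some (x * y)]/(omul (Some x) (Some y)) !omulA].
Qed.

Lemma principal_idealMl (x y : S) :
  principal_ideal (x * y) `<=` principal_ideal y.
Proof.
move=> t [u [v [_ v1 Et]]]; exists (omul u (Some x)), v.
by split=> //; [case: u {Et} | rewrite Et -[Some (x * y)]/(omul (Some x) (Some y)) !omulA].
Qed.

Lemma principal_ideal_subsemigroup (x : S) : subsemigroup (principal_ideal x).
Proof.
move=> y z [u [v [u1 v1 Ey]]] [u' [v' [u1' v1' Ez]]].
exists u, (omul v (Some z)); split=> //; first by case: v {v1 Ey}.
by rewrite omulA -Ey.
Qed.

Lemma radical_sub (x y : S) :
  principal_ideal y `<=` principal_ideal x -> radical x -> radical y.
Proof.
move=> yx [_ [m [m0 xm]]]; split; first exact: principal_ideal_subsemigroup.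
exists m; split=> //; apply/seteqP; split.
  by rewrite -xm; apply: setpow_sub.
have [z yz] : setpow (principal_ideal y) m !=set0.
  by apply: setpow_neq0; exists y; apply: principal_ideal_refl.
have := setpow_sub yx yz; rewrite xm => z0.
by move=> _ ->; rewrite -z0.
Qed.

Lemma radical0 : radical 0.
Proof.
split; first exact: principal_ideal_subsemigroup.
exists 1%N; split=> //; apply/seteqP; split.
  move=> t [u [v [_ _]]]; case: u => [u|]; case: v => [v|] /= [->];
  by rewrite ?muls0 ?mul0s.
by move=> _ ->; apply: principal_ideal_refl.
Qed.

Definition radical_ideal : ideal S :=
  @Ideal _ radical (ex_intro _ 0 radical0)
    (fun x y => radical_sub (@principal_idealMr x y))
    (fun x y => radical_sub (@principal_idealMl x y)).

End Nilpotent.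
Arguments radical S : clear implicits.
Arguments radical_ideal S : clear implicits.

(* Main.v *)
Require Import Defs.
From mathcomp Require Import all_boot all_classical.

Set Implicit Arguments.
Unset Strict Implicit.
Unset Printing Implicit Defensive.

Local Open Scope classical_set_scope.

(** Write [phi] for the canonical epimorphism and [R] for the radical.  Images
    of nilpotent subsemigroups under [phi] are nilpotent.  So are preimages: if
    [U ^ m = 0] and [R ^ n = 0], then the [m]-th power of the preimage of [U]
    lies in [R], hence its [m * n]-th power is [0].  A maximal nilpotent [T]
    therefore equals its saturation [phi^-1 (phi T)], which contains [R] since
    [T] contains [0]; maximality then transfers along [phi]. *)

Section Powers.
Variable S : semigroupType.
Implicit Types A : set S.

Lemma setmulS A A' B B' :
  A `<=` A' -> B `<=` B' -> setmul A B `<=` @setmul S A' B'.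
Proof. by move=> AA BB _ [a /AA ? [b /BB ? <-]]; exists a => //; exists b. Qed.

Lemma setpowS A m : (0 < m)%N -> setpow A m.+1 = setmul A (setpow A m).
Proof. by case: m. Qed.

(** Regrouping by associativity. Positivity matters: since [setpow A 0] is [A], the case [n = 0]
    would put the [m]-th power inside the next one. *)
Lemma setpowD A m n : (0 < m)%N -> (0 < n)%N ->
  setpow A (m + n) `<=` setmul (setpow A m) (setpow A n).
Proof.
case: m => // m _ n0; elim: m => [|m IH]; first by rewrite add1n setpowS.
rewrite addSn setpowS // => _ [a Aa [b /IH[c Ac [d Ad <-]] <-]].
by rewrite mulgA; exists (a * c)%g; [exists a => //; exists c | exists d].
Qed.

Lemma setpowM A m n : (0 < m)%N -> (0 < n)%N ->
  setpow A (n * m) `<=` setpow (setpow A m) n.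
Proof.
move=> m0; case: n => // n _; elim: n => [|n IH]; first by rewrite mul1n.
rewrite mulSn setpowS //; apply: (subset_trans (setpowD _ _)) => //.
  by rewrite muln_gt0.
exact: setmulS.
Qed.

Lemma setpow_subsemigroup A m : subsemigroup A -> setpow A m `<=` A.
Proof.
move=> sA; rewrite /setpow; elim: m.-1 => [//|k IH] _ [a Aa [b /IH Ab <-]].
exact: sA.
Qed.

End Powers.

Section NilpotentSubsemigroups.
Variable S : zeroSemigroupType.
Implicit Types T : set S.

(** Powers of a nonempty set are nonempty, so a power contained in [{0}] equals [{0}]. Later proofs
    thus only need inclusions between powers. *)
Lemma nilpotentP T :
  nilpotent T <->
  T !=set0 /\ exists2 m, (0 < m)%N & setpow T m `<=` [set 0%g].
Proof.
split=> [[m [m0 Tm]]|[T0 [m m0 Tm]]]; last first.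
  exists m; split=> //; apply/seteqP; split=> // _ ->.
  by have [x Tx] := setpow_neq0 m T0; rewrite -(Tm _ Tx).
split; last by exists m => //; rewrite Tm.
have : setpow T m 0%g by rewrite Tm.
(* If [m = 1], then [0] itself lies in [T]; otherwise [0] is a product whose first factor does. *)
by rewrite /setpow; case: m.-1 => [|k]; [exists 0%g | case=> a Ta _; exists a].
Qed.

Lemma nilpotent_subsemigroup0 T : nilpotent_subsemigroup T -> T 0%g.
Proof.
by move=> [sT [m [_ Tm]]]; apply: (setpow_subsemigroup (m := m) sT); rewrite Tm.
Qed.

End NilpotentSubsemigroups.

Section ReesQuotientMap.
Variables (S : zeroSemigroupType) (I : ideal S).
Local Notation phi := (rees_proj I).
Implicit Types (T : set S) (U : set (rees I)).

Lemma ideal0 : ideal_set I 0%g.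
Proof. by have [x Ix] := ideal_neq0 I; rewrite -(mul0s x); apply: ideal_mull. Qed.

(** The zero of the quotient is the class of [0], and [0] lies in every ideal, so this class is all
    of [I]. *)
Lemma rees_proj_eq0 x : phi x = 0%g <-> ideal_set I x.
Proof.
rewrite (rees_proj_eq I x 0%g); split=> [/orP[/eqP->|/andP[/set_mem]]//|Ix].
  exact: ideal0.
by apply/orP; right; apply/andP; split; apply/mem_set => //; exact: ideal0.
Qed.

Lemma image_rees_projK U : phi @` (phi @^-1` U) = U.
Proof.
apply/seteqP; split=> [_ [x Ux <-]//|q Uq].
by exists (repr q); rewrite /= rees_projK.
Qed.

Lemma setpow_image T m : setpow (phi @` T) m `<=` phi @` setpow T m.
Proof.
rewrite /setpow; elim: m.-1 => [//|k IH] _ [_ [x Tx <-] [_ /IH[y Ty <-] <-]].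
by exists (x * y)%g; [exists x => //; exists y | rewrite rees_projM].
Qed.

Lemma setpow_preimage U m : setpow (phi @^-1` U) m `<=` phi @^-1` setpow U m.
Proof.
rewrite /setpow; elim: m.-1 => [//|k IH] _ [x Ux [y /IH Uy <-]].
by rewrite /preimage /= rees_projM; exists (phi x) => //; exists (phi y).
Qed.

Lemma nilpotent_subsemigroup_image T :
  nilpotent_subsemigroup T -> nilpotent_subsemigroup (phi @` T).
Proof.
move=> [sT /nilpotentP[[x Tx] [m m0 Tm]]]; split.
  move=> _ _ [a Ta <-] [b Tb <-].
  by exists (a * b)%g; [exact: sT | rewrite rees_projM].
apply/nilpotentP; split; first by exists (phi x), x.
by exists m => // _ /setpow_image[y /Tm -> <-].
Qed.

Lemma nilpotent_subsemigroup_preimage U : nilpotent I ->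
  nilpotent_subsemigroup U -> nilpotent_subsemigroup (phi @^-1` U).
Proof.
move=> /nilpotentP[_ [n n0 In]] nU; have [sU /nilpotentP[_ [m m0 Um]]] := nU.
split; first by move=> x y Ux Uy; rewrite /preimage /= rees_projM; apply: sU.
apply/nilpotentP; split; first by exists 0%g; exact: nilpotent_subsemigroup0 nU.
exists (n * m)%N; first by rewrite muln_gt0 n0.
apply: subset_trans In; apply: (subset_trans (setpowM m0 n0)).
apply: setpow_sub => x /setpow_preimage /Um; exact: (rees_proj_eq0 x).1.
Qed.

Lemma maximal_nilpotent_saturated T : nilpotent I ->
  maximal_nilpotent_subsemigroup T -> phi @^-1` (phi @` T) = T.
Proof.
move=> nI [nT maxT]; apply: maxT; last exact: preimage_image.
by apply: nilpotent_subsemigroup_preimage => //; exact: nilpotent_subsemigroup_image.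
Qed.

Lemma maximal_nilpotent_sup_ideal T : nilpotent I ->
  maximal_nilpotent_subsemigroup T -> I `<=` T.
Proof.
move=> nI mT x /rees_proj_eq0 x0; rewrite -(maximal_nilpotent_saturated nI mT).
by exists 0%g; [exact: nilpotent_subsemigroup0 mT.1 | rewrite x0].
Qed.

Lemma maximal_nilpotent_image_bij : nilpotent I ->
  set_bij [set T : set S | maximal_nilpotent_subsemigroup T]
          [set U : set (rees I) | maximal_nilpotent_subsemigroup U]
          (fun T : set S => phi @` T).
Proof.
move=> nI; split.
- move=> T mT; have [nT maxT] := mT.
  split; first exact: nilpotent_subsemigroup_image.
  (* As [phi] is onto, [V] is the image of its preimage; that preimage is nilpotent and contains
     [T], hence is [T]. *)
  move=> V nV TV; rewrite -(image_rees_projK V); congr (_ @` _).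
  apply: maxT; first exact: nilpotent_subsemigroup_preimage.
  by move=> x Tx; apply: TV; exists x.
(* Injectivity: a maximal [T] is recovered from its image by saturation. *)
- move=> T T' /set_mem mT /set_mem mT' eqT.
  rewrite -(maximal_nilpotent_saturated nI mT) eqT.
  exact: maximal_nilpotent_saturated.
- move=> U [nU maxU]; exists (phi @^-1` U); last exact: image_rees_projK.
  split=> [|V nV UV]; first exact: nilpotent_subsemigroup_preimage.
  (* The image of [V] contains [phi (phi^-1 U) = U], so maximality of [U] applies; then [V] lies in
     [phi^-1 (phi V) = phi^-1 U]. *)
  have eqU : phi @` V = U.
    apply: maxU; first exact: nilpotent_subsemigroup_image.
    by rewrite -{1}(image_rees_projK U); exact: image_subset.
  apply/seteqP; split=> //; rewrite -{1}eqU; exact: preimage_image.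
Qed.

End ReesQuotientMap.

Theorem corollary3p7 (S : zeroSemigroupType)
    (hR : nilpotent_subsemigroup (radical S)) :
  (forall T : set S, maximal_nilpotent_subsemigroup T -> radical S `<=` T) /\
  set_bij [set T : set S | maximal_nilpotent_subsemigroup T]
          [set U : set (rees (radical_ideal S)) | maximal_nilpotent_subsemigroup U]
          (fun T : set S => rees_proj (radical_ideal S) @` T).
Proof.
(* The results above hold for any nilpotent ideal; the set underlying [radical_ideal S] is
   [radical S] by definition. *)
have [_ nR] := hR; split=> [T mT|].
  exact: (maximal_nilpotent_sup_ideal (I := radical_ideal S)).
exact: maximal_nilpotent_image_bij.
Qed.
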